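(* Let $(\Gamma,u)$ be a generalized $n$-gon with (non-discrete) valuation (with some weight sequence). If $3\le n\le 6$, then the residue $\Gamma_r$ defined by $u$ is a weak generalized $n$-gon (possibly a generalized $n$-gon).
   Context: Generalized polygons. A generalized $n$-gon ($n\ge 2$) $\Gamma=(P,B,\mathrm{I})$ consists of disjoint sets $P$ (points) and $B$ (lines) and a symmetric incidence relation $\mathrm{I}$ between $P$ and $B$ such that: (GP1) every element of $P\cup B$ is incident with at least three other elements; (GP2) for all $x,y\in P\cup B$ there is a sequence $x_0=x,x_1,\dots,x_k=y$ with $x_{i-1}\,\mathrm{I}\,x_i$ for $1\le i\le k$ and $k\le n$; (GP3) this sequence is unique whenever $k<n$. A weak generalized $n$-gon is defined in the same way with ''at least three'' in (GP1) replaced by ''at least two''. ''Element'' means element of $P\cup B$. A path is a finite sequence of elements, consecutive ones being incident; its length is the number of entries minus one. The distance between two elements is the length of a shortest path between them; elements at distance $n$ are opposite. Two points are collinear if incident with a common line, two lines are concurrent if incident with a common point; elements are adjacent if collinear or concurrent (an element is adjacent to itself). Valuations. A generalized $n$-gon with (non-discrete) valuation and weight sequence $(a_1,\dots,a_{n-1},a_{n+1},\dots,a_{2n-1})$, where all $a_i$ are positive real numbers, is a pair $(\Gamma,u)$ with $\Gamma$ a generalized $n$-gon and $u$ a function on pairs of adjacent elements with values in $[0,\infty]$ such that: (U1) for each element $z$ there are elements $x,y$ incident with $z$ with $u(x,y)=0$; (U2) $u(x,y)=\infty$ if and only if $x=y$; (U3) if $x,y,z$ are points on a common line or lines through a common point,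 then $u(x,y)<u(y,z)$ implies $u(x,z)=u(x,y)$; (U4) whenever $x_1\,\mathrm{I}\,x_2\,\mathrm{I}\cdots\mathrm{I}\,x_{2n}\,\mathrm{I}\,x_1$ with $x_i\in P\cup B$ (indices modulo $2n$, so $x_0=x_{2n}$), one has $\sum_{i=1}^{n-1}a_iu(x_{i-1},x_{i+1})=\sum_{i=n+1}^{2n-1}a_iu(x_{i-1},x_{i+1})$. Residue. A path $(x_0,\dots,x_m)$ has valuation zero if $u(x_{i-1},x_{i+1})=0$ for $1\le i\le m-1$. Two opposite elements are residually opposite if some (equivalently, by (U4), every) shortest path between them has valuation zero. Let $[x]_{\mathrm{opp}}$ be the set of elements residually opposite $x$. Elements $x,y$ are residually equivalent if $[x]_{\mathrm{opp}}=[y]_{\mathrm{opp}}$; the equivalence class of $x$ is written $[x]$. All elements of a class have the same type, so the classes are residual points (set $[P]$) and residual lines (set $[B]$). A residual point $[p]$ and a residual line $[L]$ are incident, $[p]\,\mathrm{I}_r\,[L]$, if there are $p'\in[p]$, $L'\in[L]$ with $p'\,\mathrm{I}\,L'$. The residue defined by $u$ is the geometry $\Gamma_r=([P],[B],\mathrm{I}_r)$. *)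

(* Defs.v *)
From HB Require Import structures.
From mathcomp Require Import all_boot all_order all_algebra.
From mathcomp Require Import boolp classical_sets cardinality reals ereal.

Set Implicit Arguments.
Unset Strict Implicit.
Unset Printing Implicit Defensive.

Import Order.TTheory GRing.Theory Num.Theory.
Local Open Scope classical_set_scope.
Local Open Scope card_scope.
Local Open Scope ring_scope.

(* Points and lines are sets in one ambient type, so that their disjointness is
   a genuine condition (in particular for the residue, whose elements are
   classes of elements). *)
Record geometry (T : Type) := Geometry {
  points : set T;
  lines : set T;
  inc : T -> T -> Prop }.

Section Geometry.
Variables (T : Type) (G : geometry T).

Definition elements : set T := points G `|` lines G.

Definition well_formed : Prop :=
  [/\ points G `&` lines G = set0,
      forall x y, inc G x y -> inc G y x
    & forall x y, inc G x y ->
        (points G x /\ lines G y) \/ (lines G x /\ points G y)].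

(* (w 0, ..., w m) is a path; the values of w beyond m are irrelevant. *)
Definition is_path (m : nat) (w : nat -> T) : Prop :=
  (forall i, (i <= m)%N -> elements (w i)) /\
  (forall i, (i < m)%N -> inc G (w i) (w i.+1)).

Definition path_from_to (m : nat) (w : nat -> T) (x y : T) : Prop :=
  [/\ is_path m w, w 0%N = x & w m = y].

Definition at_distance (k : nat) (x y : T) : Prop :=
  (exists w, path_from_to k w x y) /\
  (forall l w, path_from_to l w x y -> (k <= l)%N).

Definition collinear (x y : T) : Prop :=
  [/\ points G x, points G y
    & exists L, [/\ lines G L, inc G x L & inc G y L]].

Definition concurrent (x y : T) : Prop :=
  [/\ lines G x, lines G y
    & exists p, [/\ points G p, inc G x p & inc G y p]].

Definition adjacent (x y : T) : Prop := collinear x y \/ concurrent x y.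

(* m = 3 for generalized, m = 2 for weak generalized n-gons.  Uniqueness (GP3)
   concerns the sequences of minimal length, i.e. k is the distance from x to y:
   sequences may repeat elements, so x, z, x and x (or x, z, x, y and x, y)
   always coexist. *)
Record polygon_axioms (m n : nat) : Prop := PolygonAxioms {
  polygon_n_ge2 : (2 <= n)%N;
  polygon_wf : well_formed;
  polygon_GP1 : forall x, elements x -> `I_m #<= [set y | inc G x y];
  polygon_GP2 : forall x y, elements x -> elements y ->
    exists k w, (k <= n)%N /\ path_from_to k w x y;
  polygon_GP3 : forall x y k v w, (k < n)%N -> at_distance k x y ->
    path_from_to k v x y -> path_from_to k w x y ->
    forall i, (i <= k)%N -> v i = w i }.

Definition generalized_polygon (n : nat) : Prop := polygon_axioms 3 n.
Definition weak_generalized_polygon (n : nat) : Prop := polygon_axioms 2 n.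

End Geometry.

Section Valuation.
Variables (R : realType) (T : Type) (n : nat) (G : geometry T).

(* Only the values of u at adjacent pairs, and of a at the indices 1, ..., n-1
   and n+1, ..., 2n-1, are constrained or used.  Symmetry of u on adjacent
   pairs follows from (U2) and (U3) with z = x. *)
Record valuation (a : nat -> R) (u : T -> T -> \bar R) : Prop := Valuation {
  valuation_weight_gt0 : forall i,
    ((0 < i < n) || (n < i < n.*2))%N -> 0 < a i;
  valuation_ge0 : forall x y, adjacent G x y -> (0 <= u x y)%E;
  valuation_U1 : forall z, elements G z ->
    exists x y, [/\ inc G x z, inc G y z & u x y = 0%E];
  valuation_U2 : forall x y, adjacent G x y -> (u x y = +oo%E <-> x = y);
  valuation_U3 : forall x y z,
    (exists t, [/\ inc G x t, inc G y t & inc G z t]) ->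
    (u x y < u y z)%E -> u x z = u x y;
  valuation_U4 : forall x : nat -> T,
    (forall i, (i < n.*2)%N -> inc G (x i) (x i.+1)) -> x n.*2 = x 0%N ->
    (\sum_(1 <= i < n) (a i)%:E * u (x i.-1) (x i.+1) =
     \sum_(n.+1 <= i < n.*2) (a i)%:E * u (x i.-1) (x i.+1))%E }.

Definition generalized_polygon_with_valuation
    (a : nat -> R) (u : T -> T -> \bar R) : Prop :=
  generalized_polygon G n /\ valuation a u.

Variable u : T -> T -> \bar R.

Definition valuation_zero (m : nat) (w : nat -> T) : Prop :=
  forall i, (0 < i < m)%N -> u (w i.-1) (w i.+1) = 0%E.

Definition opposite (x y : T) : Prop := at_distance G n x y.

Definition residually_opposite (x y : T) : Prop :=
  opposite x y /\ exists w, path_from_to G n w x y /\ valuation_zero n w.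

Definition residual_opp (x : T) : set T :=
  [set y | residually_opposite x y].

Definition residual_class (x : T) : set T :=
  [set y | elements G y /\ residual_opp x = residual_opp y].

Definition residual_points : set (set T) :=
  [set residual_class p | p in points G].

Definition residual_lines : set (set T) :=
  [set residual_class L | L in lines G].

Definition residual_inc (C D : set T) : Prop :=
  ((residual_points C /\ residual_lines D) \/
   (residual_lines C /\ residual_points D)) /\
  exists x y, [/\ C x, D y & inc G x y].

Definition residue : geometry (set T) :=
  Geometry residual_points residual_lines residual_inc.

End Valuation.

(* Main.v *)
Require Import Defs.
From mathcomp Require Import all_boot all_order all_algebra.
From mathcomp Require Import boolp classical_sets cardinality reals ereal.
From mathcomp Require Import zify.

Set Implicit Arguments.
Unset Strict Implicit.
Unset Printing Implicit Defensive.

Import Order.TTheory GRing.Theory Num.Theory.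

(** Elements with the same residual opposites are called equivalent, written
    [x ~ y], and a walk is straight when its valuation is zero.  By (U4) a
    straight walk of length [n] joins residually opposite elements, and every
    walk of length [n] between residually opposite elements is straight
    ([opp_walk_straight]).  So adjacent elements are equivalent if and only if
    their [u]-value is nonzero ([adjacent_equiv], [equiv_adjacent]), and the ends
    of a straight walk of length strictly between [0] and [2n] are never
    equivalent ([straight_inequiv]).

    Everything then rests on lifting residual incidences: if [p ~ p'] and [p] is
    incident with [L], some [L' ~ L] is incident with [p'] ([equiv_lift]).  Given
    this, a shortest path of the residue lifts, from any representative of its
    first element, to a straight walk of the polygon.  If two shortest paths of
    length [k < n] with the same ends separated, their lifts from the last common
    element would form one straight walk of length at most [2k < 2n] with
    equivalent ends, which is impossible; this is (GP3).

    For lifting, let [X] and [Y] be straight walks of length [n] with the same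
    ends, leaving the first one along equivalent elements ([bigon X Y]).  They
    bound an apartment that is folded in the residue along the axis through
    these two ends, so one expects [X i ~ Y i] for all [i].
    This is [bigon_equiv].  For [i = 1] and [i = n - 1] it follows from (U4); for
    [i = 2] and [i = n - 2] from the combinatorial argument of
    [bigons_diverge], which exploits that [n] is small; for [n <= 6] the
    only index left is [n = 6, i = 3], handled in [bigon_opp3].  Lifting from [p]
    to [p'] follows by induction on the length of a walk between them: the walk
    is not straight, and folding at its first nonzero turn carries [p] and [L] to
    equivalent elements two steps closer to [p']. *)

Section Walks.
Variables (R : realType) (T : Type) (n : nat) (G : geometry T).
Variables (a : nat -> R) (u : T -> T -> \bar R).
Hypothesis n_gt2 : (2 < n)%N.
Hypothesis polG : generalized_polygon G n.
Hypothesis valG : valuation n G a u.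

Local Notation I := (inc G).
Local Notation opp := (residually_opposite n G u).
Local Notation "x ~ y" := (residual_opp n G u x = residual_opp n G u y)
  (at level 70).

(** * Walks and turns *)

Definition walk (m : nat) (w : nat -> T) := forall i, i < m -> I (w i) (w i.+1).

Definition straight (m : nat) (w : nat -> T) :=
  walk m w /\ valuation_zero u m w.

Definition fwd (s : nat) (w : nat -> T) (i : nat) := w (s + i).
Definition bwd (s : nat) (w : nat -> T) (i : nat) := w (s - i).

(** From [v k] back along [v] to the common origin [v 0 = w 0], then out along
    [w] to [w l]; the turn at the origin is the one between [v 1] and [w 1]. *)
Definition glue (k : nat) (v w : nat -> T) (i : nat) :=
  if i <= k then v (k - i) else w (i - k).

Lemma inc_sym x y : I x y -> I y x.
Proof. by have [_ H _] := polygon_wf polG; exact: H. Qed.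

Lemma inc_type x y : I x y ->
  (points G x /\ lines G y) \/ (lines G x /\ points G y).
Proof. by have [_ _ H] := polygon_wf polG; exact: H. Qed.

Lemma inc_element x y : I x y -> elements G x.
Proof. by move/inc_type => [[H _]|[H _]]; [left|right]. Qed.

Lemma point_not_line x : points G x -> lines G x -> False.
Proof.
have [H _ _] := polygon_wf polG => Px Lx.
by suff : set0 x by []; rewrite -H; split.
Qed.

Lemma inc_pointN x y : I x y -> `[< points G y >] = ~~ `[< points G x >].
Proof.
move/inc_type => [[px ly]|[lx py]].
  by rewrite (asboolT px); apply/asboolPn => py; exact: point_not_line py ly.
rewrite (asboolT py); apply/esym/negP => /asboolP px.
exact: point_not_line px lx.
Qed.

Lemma walk_point m w : walk m w ->
  `[< points G (w m) >] = odd m (+) `[< points G (w 0) >].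
Proof.
elim: m => [|m IH] W //=.
rewrite (inc_pointN (W m (ltnSn m))) IH => [|i im]; first by rewrite addNb.
by apply: W; rewrite ltnS ltnW.
Qed.

Lemma walk_parity k l v w : walk k v -> walk l w ->
  v 0 = w 0 -> v k = w l -> odd k = odd l.
Proof.
move=> /walk_point Hv /walk_point Hw E0 E1.
by move: Hv; rewrite E1 Hw E0 => /addIb.
Qed.

Lemma inc_adjacent x y z : I x z -> I y z -> adjacent G x y.
Proof.
move=> xz yz.
case: (inc_type xz) => -[H1 H2]; case: (inc_type yz) => -[H3 H4].
- by left; split=> //; exists z.
- by case: (point_not_line H4 H2).
- by case: (point_not_line H2 H4).
- by right; split=> //; exists z.
Qed.

Lemma u_diag x z : I x z -> u x x = +oo%E.
Proof. by move=> xz; apply/(valuation_U2 valG) => //; exact: (inc_adjacent xz xz). Qed.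

Lemma u_ge0 x y z : I x z -> I y z -> (0 <= u x y)%E.
Proof. by move=> xz yz; apply: (valuation_ge0 valG); exact: inc_adjacent xz yz. Qed.

(** Symmetry is (U3) with two equal entries: a strict inequality between
    [u x y] and [u y x] would force the smaller one to equal the infinite value
    on the diagonal. *)
Lemma u_sym x y z : I x z -> I y z -> u x y = u y x.
Proof.
have aux x' y' : I x' z -> I y' z -> (u x' y' < u y' x')%E -> False.
  move=> xz yz lt_u.
  have E : u x' x' = u x' y'.
    by apply: (valuation_U3 valG) lt_u; exists z.
  by move: lt_u; rewrite -E (u_diag xz) ltNge leey.
move=> xz yz; case: (ltgtP (u x y) (u y x)) => // H; exfalso.
  exact: aux xz yz H.
exact: aux yz xz H.
Qed.

Lemma u_eq0_transfer x y z t : I x t -> I y t -> I z t ->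
  u x y = 0%E -> u y z <> 0%E -> u x z = 0%E.
Proof.
move=> xt yt zt xy0 yz.
rewrite -xy0; apply: (valuation_U3 valG); first by exists t.
by rewrite xy0 lt0e (u_ge0 yt zt) andbT; apply/eqP.
Qed.

(** (U1) provides two elements with value zero; by (U3) one of the two has value
    zero against [x]. *)
Lemma straight_step x z : I x z -> exists2 y, I z y & u x y = 0%E.
Proof.
move=> xz; have zx := inc_sym xz.
have [y [y' [yz y'z yy']]] := valuation_U1 valG (inc_element zx).
case: (pselect (u x y = 0%E)) => [H|H]; first by exists y => //; exact: inc_sym.
exists y'; first exact: inc_sym.
rewrite (u_sym xz y'z).
apply: (u_eq0_transfer y'z yz xz); first by rewrite (u_sym y'z yz).
by rewrite (u_sym yz xz).
Qed.

Lemma walk_fwd s k m w : s + k <= m -> walk m w -> walk k (fwd s w).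
Proof. by move=> le_m W i ik; rewrite /fwd addnS; apply: W; lia. Qed.

Lemma walk_bwd s k m w : k <= s <= m -> walk m w -> walk k (bwd s w).
Proof.
move=> /andP[ks sm] W i ik; apply: inc_sym; rewrite /bwd.
have -> : s - i = (s - i.+1).+1 by lia.
by apply: W; lia.
Qed.

Lemma glue_le k v w i : i <= k -> glue k v w i = v (k - i).
Proof. by rewrite /glue => ->. Qed.

Lemma glue_add k v w i : v 0 = w 0 -> glue k v w (k + i) = w i.
Proof.
move=> E; rewrite /glue; case: i => [|i]; first by rewrite addn0 leqnn subnn.
by rewrite addnS ltnNge leq_addr /= -addnS addKn.
Qed.

Lemma walk_glue k l v w : walk k v -> walk l w -> v 0 = w 0 ->
  walk (k + l) (glue k v w).
Proof.
move=> Wv Ww E i ikl; case: (ltnP i k) => ik.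
  rewrite !glue_le //; last exact: ltnW.
  have -> : k - i = (k - i.+1).+1 by lia.
  by apply/inc_sym/Wv; lia.
rewrite -(subnKC ik) -addnS !glue_add //.
by apply: Ww; lia.
Qed.

Lemma straight_fwd s k m w : s + k <= m -> straight m w -> straight k (fwd s w).
Proof.
move=> le_m [W Z]; split; first exact: walk_fwd le_m W.
move=> [|i] // ik; rewrite /fwd /= !addnS; apply: (Z (s + i).+1); lia.
Qed.

Lemma straight_bwd s k m w : k <= s <= m -> straight m w -> straight k (bwd s w).
Proof.
move=> ksm [W Z]; split; first exact: walk_bwd ksm W.
move=> [|i] // ik; rewrite /bwd /=.
have -> : s - i = (s - i.+2).+2 by lia.
rewrite (@u_sym _ _ (w (s - i.+2).+1)).
- by apply: (Z (s - i.+2).+1); lia.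
- by apply/inc_sym/W; lia.
- by apply: W; lia.
Qed.

Lemma straight_glue k l v w : straight k v -> straight l w -> v 0 = w 0 ->
  u (v 1) (w 1) = 0%E -> straight (k + l) (glue k v w).
Proof.
move=> [Wv Zv] [Ww Zw] E u0; split; first exact: walk_glue.
move=> [|i] // ikl /=; case: (ltngtP i.+1 k) => ik.
- rewrite !glue_le; try lia.
  have -> : k - i = (k - i.+2).+2 by lia.
  rewrite (@u_sym _ _ (v (k - i.+2).+1)).
  - by apply: (Zv (k - i.+2).+1); lia.
  - by apply/inc_sym/Wv; lia.
  - by apply: Wv; lia.
- have -> : i = k + (i - k) by lia.
  rewrite -!addnS !glue_add //.
  have -> : i - k = (i - k).+1.-1 by [].
  by apply: Zw; lia.
rewrite glue_le; last lia.
have -> : i.+2 = k + 1 by lia.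
rewrite glue_add //; have -> // : k - i = 1 by lia.
Qed.

Lemma straight_reduced m w i : straight m w -> 0 < i < m -> w i.-1 <> w i.+1.
Proof.
move=> [W Z]; case: i => [|i] // im E.
have := Z _ im; rewrite -E (@u_diag _ (w i.+1)) //.
by apply: W; lia.
Qed.

Lemma walk_path m w : elements G (w 0) -> walk m w -> is_path G m w.
Proof.
move=> E0 W; split=> // -[|i] im //.
exact: inc_element (inc_sym (W i im)).
Qed.

Lemma path_walk m w : is_path G m w -> walk m w.
Proof. by case. Qed.

(** Induction on [k]: a shortcut to the last element has the parity of [k], so
    by the induction hypothesis it extends to a second shortest walk to the
    element before it, and (GP3) makes the given walk backtrack. *)
Lemma straight_distance k w : 0 < k <= n -> straight k w ->
  at_distance G k (w 0) (w k).
Proof.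
case: k => [|k] //; elim: k => [|k IH] kn S.
  have w01 : I (w 0) (w 1) by apply: (proj1 S).
  split.
    exists w; split=> //; apply: walk_path; last exact: (proj1 S).
    exact: inc_element w01.
  move=> [|l] v [/path_walk V V0 V1] //.
  by have := walk_parity V (proj1 S) V0 V1.
have E0 : elements G (w 0) by apply: (@inc_element _ (w 1)); apply: (proj1 S).
have S1 : straight k.+1 w.
  by case: S => W Z; split=> i ik; [apply: W | apply: Z]; lia.
have [_ D] := IH (ltnW kn) S1.
split; first by exists w; split=> //; apply: walk_path; last exact: (proj1 S).
move=> l v [/path_walk V V0 Vl]; rewrite leqNgt; apply/negP => lk.
have par := walk_parity V (proj1 S) V0 Vl.
pose v' i := if i <= l then v i else w k.+1.
have V' : walk l.+1 v'.
  move=> i il; rewrite /v'; case: (ltngtP i l) => il'; [|lia|].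
    by apply: V.
  by rewrite il' Vl; apply/inc_sym/(proj1 S).
have P' : path_from_to G l.+1 v' (w 0) (w k.+1).
  split; last by rewrite /v' ltnn.
    by apply: walk_path; rewrite // /v' /= V0.
  by rewrite /v' /= V0.
have le_kl := D _ _ P'.
have El : l = k by move: par lk le_kl => /= par; lia.
subst l.
have := polygon_GP3 polG kn (IH (ltnW kn) S1) P'.
have P1 : path_from_to G k.+1 w (w 0) (w k.+1).
  by split=> //; apply: walk_path; last exact: (proj1 S1).
move=> /(_ _ P1 k (leqnSn k)).
rewrite /v' leqnn Vl => E.
by apply: (straight_reduced S (i := k.+1)) => //=; lia.
Qed.

(** * Residual opposition *)

Lemma oppP x y :
  opp x y <-> exists w, [/\ straight n w, w 0 = x & w n = y].
Proof.
split=> [[_ [w [[/path_walk W W0 Wn] Z]]]|[w [S <- <-]]].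
  by exists w.
have D : opposite n G (w 0) (w n) by apply: straight_distance => //; lia.
split=> //; exists w; split; last exact: (proj2 S).
split=> //; apply: walk_path; last exact: (proj1 S).
by apply: (@inc_element _ (w 1)); apply: (proj1 S); lia.
Qed.

Lemma straight_opp w : straight n w -> opp (w 0) (w n).
Proof. by move=> S; apply/oppP; exists w. Qed.

Lemma opp_glue k l v w : k + l = n -> straight k v -> straight l w ->
  v 0 = w 0 -> u (v 1) (w 1) = 0%E -> opp (v k) (w l).
Proof.
move=> kl Sv Sw E u0; have := straight_glue Sv Sw E u0; rewrite kl.
by move/straight_opp; rewrite glue_le // subn0 -kl glue_add.
Qed.

Lemma opp_sym x y : opp x y -> opp y x.
Proof.
move=> /oppP[w [S <- <-]].
have := straight_opp (straight_bwd (s := n) (k := n) _ S).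
by rewrite /bwd subn0 subnn; apply; rewrite leqnn.
Qed.

Lemma opp_element x y : opp x y -> elements G x.
Proof.
move=> /oppP[w [[W _] <- _]]; apply: (@inc_element _ (w 1)); apply: W; lia.
Qed.

Lemma opp_far x y m w : opp x y -> walk m w -> w 0 = x -> w m = y -> n <= m.
Proof.
move=> xy W W0 Wm; have [[_ D] _] := xy; apply: (D m w); split=> //.
by apply: walk_path => //; rewrite W0; exact: opp_element xy.
Qed.

Lemma opp_glue_far k l v w : opp (v k) (w l) -> walk k v -> walk l w ->
  v 0 = w 0 -> n <= k + l.
Proof.
move=> vw Wv Ww E; apply: opp_far vw (walk_glue Wv Ww E) _ _.
  by rewrite glue_le // subn0.
exact: glue_add.
Qed.

(** (U4) for the closed walk out along [w] and back along [v]: the half belonging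
    to [w] sums to zero, so the nonnegative terms of the other half vanish, and
    the weights are positive. *)
Lemma walk_straight v w : straight n w -> walk n v -> v 0 = w 0 -> v n = w n ->
  straight n v.
Proof.
move=> [W Z] V E0 En; split=> // i i_n.
pose c j := if j <= n then w j else v (n.*2 - j).
have cl j : j <= n -> c j = w j by rewrite /c => ->.
have cr j : n <= j -> c j = v (n.*2 - j).
  rewrite /c leq_eqVlt => /orP[/eqP<-|nj].
    by rewrite leqnn -En; congr v; lia.
  by rewrite leqNgt nj.
have Wc j : j < n.*2 -> I (c j) (c j.+1).
  move=> jn; case: (ltnP j n) => nj.
    by rewrite !cl //; [exact: W | exact: ltnW].
  rewrite !cr //; last exact: leqW.
  have -> : n.*2 - j = (n.*2 - j.+1).+1 by lia.
  by apply/inc_sym/V; lia.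
have Ec : c n.*2 = c 0 by rewrite cr ?cl //; [rewrite subnn | lia].
have := valuation_U4 valG Wc Ec.
rewrite [LHS]big_nat_cond big1; last first.
  move=> j /andP[jn _]; rewrite !cl; try lia.
  by rewrite Z ?mule0.
move/esym => S0.
have ge0 j : n < j < n.*2 -> (0 <= (a j)%:E * u (c j.-1) (c j.+1))%E.
  move=> jn; apply: mule_ge0.
    by rewrite lee_fin ltW // (valuation_weight_gt0 valG) // jn orbT.
  apply: (@u_ge0 _ _ (c j)).
    by have := Wc j.-1; rewrite prednK; [apply; lia | lia].
  by apply/inc_sym/Wc; lia.
set j := n.*2 - i; have jn : n < j < n.*2 by lia.
suff : ((a j)%:E * u (c j.-1) (c j.+1) = 0)%E.
  move/eqP; rewrite mule_eq0 eqe => /orP[/eqP aj0|/eqP].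
    suff : (0 < a j)%R by rewrite aj0 ltxx.
    by rewrite (valuation_weight_gt0 valG) // jn orbT.
  rewrite !cr; try lia.
  have -> : n.*2 - j.-1 = i.+1 by lia.
  have -> : n.*2 - j.+1 = i.-1 by lia.
  rewrite (@u_sym _ _ (v i)) //.
    by apply/inc_sym/V; lia.
  by have := V i.-1; rewrite prednK; [apply; lia | lia].
apply/eqP; rewrite eq_le ge0 // andbT.
move/eqP: S0; rewrite eq_le => /andP[+ _]; apply: le_trans.
rewrite (big_cat_nat (n := j)) /=; try lia.
rewrite [X in (_ <= _ + X)%E]big_ltn; last lia.
rewrite addeA addeC; rewrite addeA.
have pos k l : n < k -> l <= n.*2 ->
  (0 <= \sum_(k <= i0 < l) (a i0)%:E * u (c i0.-1) (c i0.+1))%E.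
  move=> nk ln; rewrite big_nat_cond; apply: sume_ge0 => i0 /andP[H _].
  by apply: ge0; lia.
by apply: leeDr; apply: adde_ge0; apply: pos; lia.
Qed.

Lemma opp_walk_straight w : opp (w 0) (w n) -> walk n w -> straight n w.
Proof.
move=> /oppP[v [S E0 En]] W.
exact: (walk_straight S W (esym E0) (esym En)).
Qed.

Lemma opp_glue_turn k l v w : 0 < k -> 0 < l -> k + l = n ->
  opp (v k) (w l) -> walk k v -> walk l w -> v 0 = w 0 -> u (v 1) (w 1) = 0%E.
Proof.
move=> k0 l0 kl O Wv Ww E.
have En : glue k v w n = w l by rewrite -kl glue_add.
have O' : opp (glue k v w 0) (glue k v w n) by rewrite En glue_le // subn0.
have [] := opp_walk_straight O'; first by rewrite -kl; exact: walk_glue.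
move=> _ /(_ k); rewrite glue_le ?leq_pred // -(addn1 k) glue_add //.
by rewrite (_ : k - k.-1 = 1); [apply; lia | lia].
Qed.

Lemma straight_extend k m w : 0 < k <= m -> straight k w ->
  exists2 v, straight m v & forall i, i <= k -> v i = w i.
Proof.
move=> /andP[k0]; elim: m => [|m IH]; first by rewrite leqn0 => /eqP k1; lia.
rewrite leq_eqVlt => /orP[/eqP<- S|km S]; first by exists w.
have [v [W Z] vE] := IH km S.
have [y my uy] : exists2 y, I (v m) y & u (v m.-1) y = 0%E.
  apply: straight_step; have := W m.-1; rewrite prednK; first by apply; lia.
  by lia.
exists (fun i => if i <= m then v i else y); last first.
  by move=> i ik; rewrite ifT ?vE //; lia.
split=> [i im|i im].
  case: (ltngtP i m) => im'; [|lia|by rewrite im'].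
  exact: W.
rewrite ifT; last lia.
case: (ltngtP i m) => im'; [|lia|by rewrite im'].
by apply: Z; lia.
Qed.

(** (GP2) gives a walk from [z] to [y] of length at most [n]; parity and the
    distance from [x] to [y] force its length to be [n - 1]. *)
Lemma opp_walk_through x y z : opp x y -> I x z ->
  exists w, [/\ straight n w, w 0 = x, w 1 = z & w n = y].
Proof.
move=> O xz.
have [k [w [kn [/path_walk W W0 Wk]]]] :=
  polygon_GP2 polG (inc_element (inc_sym xz)) (opp_element (opp_sym O)).
pose w' i := if i is j.+1 then w j else x.
have W' : walk k.+1 w' by move=> [|i] ik /=; [rewrite W0 | apply: W].
have nk := opp_far O W' erefl Wk.
have /oppP[v [[V _] V0 Vn]] := O.
have par := walk_parity W' V (esym V0) (etrans Wk (esym Vn)).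
have kE : k.+1 = n by move: par => /=; lia.
exists w'; split=> //; last by rewrite -kE.
apply: opp_walk_straight; last by rewrite -kE.
by rewrite -[in w' n]kE /= Wk.
Qed.

Lemma equiv_opp x y z : x ~ y -> opp x z -> opp y z.
Proof. by move=> E O; have : residual_opp n G u x z by []; rewrite E. Qed.

Lemma equivI x y : (forall z, opp x z -> opp y z) ->
  (forall z, opp y z -> opp x z) -> x ~ y.
Proof. by move=> H1 H2; apply/seteqP; split=> z; [exact: H1 | exact: H2]. Qed.

(** For [t] residually opposite [x], a straight walk from [x] to [t] can be taken
    through the common neighbour [z]; replacing its first element by [y] keeps it
    straight by (U3). *)
Lemma adjacent_equiv x y z : I x z -> I y z -> u x y <> 0%E -> x ~ y.
Proof.
have aux x' y' t : I x' z -> I y' z -> u x' y' <> 0%E -> opp x' t -> opp y' t.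
  move=> xz yz uxy O.
  have [w [[W Z] W0 W1 Wn]] := opp_walk_through O xz.
  have z2 : I (w 2) z by rewrite -W1; apply/inc_sym/W; lia.
  apply/oppP; exists (fun i => if i is 0 then y' else w i).
  split=> //; last by case: (n) n_gt2 Wn.
  split=> [[|i] i_n|[|[|i]] i_n] //=; first by rewrite W1.
    by apply: W.
    rewrite (u_sym yz z2); apply: (u_eq0_transfer z2 xz yz) uxy.
    by rewrite (u_sym z2 xz) -W0; exact: (Z 1).
  exact: (Z i.+2).
move=> xz yz uxy; apply: equivI => t; first exact: aux uxy.
by apply: aux => //; rewrite (u_sym yz xz).
Qed.

(** One end is residually opposite an element, on the walk or on a prolongation
    of it, that is at distance less than [n] from the other end. *)
Lemma straight_inequiv m w : 0 < m < n.*2 -> straight m w -> ~ w 0 ~ w m.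
Proof.
move=> mn S E; case: (leqP n m) => nm.
  have Sn : straight n w by apply: (straight_fwd (s := 0) _ S); lia.
  have O := opp_sym (equiv_opp E (straight_opp Sn)).
  have := opp_far O (walk_fwd (s := n) (k := m - n) _ (proj1 S)).
  rewrite /fwd addn0 subnKC // => /(_ (leqnn m) erefl erefl); lia.
have Sb : straight m (bwd m w) by apply: straight_bwd S; rewrite leqnn.
have [|v Sv vE] := straight_extend (m := n) _ Sb; first lia.
have O := straight_opp Sv; rewrite vE // /bwd subn0 in O.
have := opp_far (equiv_opp (esym E) O) (walk_fwd (s := m) (k := n - m) _ (proj1 Sv)).
rewrite /fwd addn0 subnKC; last exact: ltnW.
by rewrite vE // /bwd subnn => /(_ (leqnn n) erefl erefl); lia.
Qed.

(** * Folded apartments *)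

(** An apartment whose valuation vanishes except at the two opposite elements
    [X 0] and [X n]; in the residue its two halves are identified
    (see [bigon_equiv]). *)
Definition bigon (X Y : nat -> T) :=
  [/\ straight n X, straight n Y, X 0 = Y 0, X n = Y n & u (X 1) (Y 1) <> 0%E].

Lemma bigon_sym X Y : bigon X Y -> bigon Y X.
Proof.
move=> [SX SY E0 En u1]; split=> //; rewrite (@u_sym _ _ (X 0)) //.
  by rewrite E0; apply/inc_sym/(proj1 SY); lia.
by apply/inc_sym/(proj1 SX); lia.
Qed.

(** Were the turn at [X n] zero, [X 1] would be residually opposite to [Y 1] via
    [X n], so the walk between them through [X 0] would be straight. *)
Lemma bigon_last X Y : bigon X Y -> u (X n.-1) (Y n.-1) <> 0%E.
Proof.
move=> [SX SY E0 En u1] un; apply: u1.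
have SX1 : straight 1 (bwd n X) by apply: straight_bwd SX; lia.
have SY1 : straight n.-1 (bwd n Y) by apply: straight_bwd SY; lia.
have O : opp (bwd n X 1) (bwd n Y n.-1).
  apply: opp_glue => //; first lia.
  - by rewrite /bwd !subn0.
  - by rewrite /bwd !subn1.
rewrite /bwd subn1 in O.
apply: (opp_glue_turn (k := n.-1) (l := 1)) => //; try lia.
- by rewrite (_ : n - n.-1 = 1) in O; last lia.
- by apply: (walk_fwd (s := 0) _ (proj1 SX)); lia.
- by apply: (walk_fwd (s := 0) _ (proj1 SY)); lia.
Qed.

Lemma bigon_rev X Y : bigon X Y -> bigon (bwd n X) (bwd n Y).
Proof.
move=> B; have := bigon_last B; case: B => SX SY E0 En _ un.
split; rewrite /bwd ?subn0 ?subn1 ?subnn //.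
  by apply: straight_bwd SX; rewrite leqnn.
by apply: straight_bwd SY; rewrite leqnn.
Qed.

Lemma bigon_exists X y : straight n X -> I (X 0) y -> u (X 1) y <> 0%E ->
  exists2 Y, bigon X Y & Y 1 = y.
Proof.
move=> SX Xy u1.
have [Y [SY Y0 Y1 Yn]] := opp_walk_through (straight_opp SX) Xy.
by exists Y => //; split=> //; rewrite Y1.
Qed.

Lemma bigon_equiv1 X Y : bigon X Y -> X 1 ~ Y 1.
Proof.
move=> [SX SY E0 En u1]; apply: (@adjacent_equiv _ _ (X 0)) => //.
  by apply/inc_sym/(proj1 SX); lia.
by rewrite E0; apply/inc_sym/(proj1 SY); lia.
Qed.

Lemma bigon_equiv_last X Y : bigon X Y -> X n.-1 ~ Y n.-1.
Proof. by move/bigon_rev/bigon_equiv1; rewrite /bwd subn1. Qed.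

(** If two bigons have the same first two elements on one side and the same
    first three on the other, their third elements on the first side are
    equivalent.  Suppose not.  Then [X 3] is residually opposite to [F n.-1], hence
    to [F' n.-1], and there is a straight walk [E] of length [n - 1] from [X 3] to
    [F' n.-2].  If [E] departs from [X 2] with turn zero, the walk from [X 0] to
    [X 3] followed by [E] is the first side of a bigon whose second side runs
    along [F'] and returns along [E]; by [bigon_last] the walk [E] would have a
    nonzero turn.  Otherwise [E] departs from [X 4] with turn zero, so [E 4] is
    residually opposite to [X n.-1], hence to [Y n.-1]; but it is close to
    [Y n.-1] through the shared element [Y 2 = F' 2], which is absurd at once for
    [n = 5], and after one more step for [n = 6]. *)
Lemma bigons_diverge X Y F F' : 3 < n <= 6 -> bigon X Y -> bigon F F' ->
  F 0 = X 0 -> F 1 = X 1 -> F' 1 = Y 1 -> F' 2 = Y 2 ->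
  u (X 2) (F 2) <> 0%E.
Proof.
move=> n46 BX BF F0 F1 F'1 F'2 u2.
have [SX SY XY0 XYn u1] := BX; have [SF SF' FF'0 FF'n v1] := BF.
have O : opp (X 3) (F' n.-1).
  apply: opp_sym; apply: (equiv_opp (bigon_equiv_last BF)); apply: opp_sym.
  have <- : fwd 1 F (n - 2) = F n.-1 by rewrite /fwd; congr F; lia.
  apply: (@opp_glue 2 (n - 2) (fwd 1 X)) => //; first lia.
    by apply: straight_fwd SX; lia.
  by apply: straight_fwd SF; lia.
have near : n < 6 -> ~ opp (Y n.-1) (F' 3).
  move=> n5; have <- : fwd 2 Y (n - 3) = Y n.-1 by rewrite /fwd; congr Y; lia.
  move=> /(@opp_glue_far _ 1 _ (fwd 2 F')) far.
  suff : n <= n - 3 + 1 by lia.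
  apply: far => //.
    by apply: walk_fwd (proj1 SY); lia.
  by apply: walk_fwd (proj1 SF'); lia.
have equivXY := bigon_equiv_last BX.
case: (ltngtP 4 n) => n4; [|lia|]; last first.
  (* For n = 4 the elements X 3 and X n.-1 coincide. *)
  apply: near; first lia.
  have n3 : n.-1 = 3 by lia.
  by apply: (equiv_opp equivXY); move: O; rewrite n3.
have [V [SV V0 V1 Vn]] : exists V,
    [/\ straight n V, V 0 = F' n.-1, V 1 = F' n.-2 & V n = X 3].
  apply: opp_walk_through (opp_sym O) _.
  by apply/inc_sym; have := proj1 SF' n.-2; rewrite prednK; [apply; lia | lia].
set E := bwd n V.
have E0 : E 0 = X 3 by rewrite /E /bwd subn0.
have En1 : E n.-1 = F' n.-2 by rewrite -V1 /E /bwd; congr V; lia.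
have En : E n = F' n.-1 by rewrite -V0 /E /bwd subnn.
have SE : straight n E by apply: straight_bwd SV; rewrite leqnn.
have X23 : I (X 2) (X 3) by apply: (proj1 SX); lia.
have X43 : I (X 4) (X 3) by apply/inc_sym/(proj1 SX); lia.
have E13 : I (E 1) (X 3) by rewrite -E0; apply/inc_sym/(proj1 SE); lia.
(* E makes a nonzero turn with X 2, by the bigon X', Y' described above. *)
have uE : u (E 1) (X 2) <> 0%E.
  move=> uE.
  have OM : opp (X 0) (E (n - 3)).
    apply: (@opp_glue 3 (n - 3) (bwd 3 X)) => //; first lia.
    - by apply: straight_bwd SX; lia.
    - by apply: (straight_fwd (s := 0) _ SE); lia.
    - by rewrite (@u_sym _ _ (X 3)).
  pose X' := glue 3 (bwd 3 X) E.
  pose Y' := glue (n - 2) (bwd (n - 2) F') (bwd n.-1 E).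
  have SX' : straight n X'.
    have n3 : 3 + (n - 3) = n by lia.
    rewrite -[n in straight n]n3; apply: straight_glue => //.
    - by apply: straight_bwd SX; lia.
    - by apply: (straight_fwd (s := 0) _ SE); lia.
    - by rewrite (@u_sym _ _ (X 3)).
  have X'_end k : X' (3 + k) = E k by rewrite /X' glue_add.
  have Y'_beg k : k <= n - 2 -> Y' k = F' k.
    by move=> kn; rewrite /Y' glue_le // /bwd; congr F'; lia.
  have Y'0 : bwd (n - 2) F' 0 = bwd n.-1 E 0 by rewrite /bwd !subn0 En1; congr F'; lia.
  have Y'_end k : Y' (n - 2 + k) = E (n.-1 - k) by rewrite /Y' glue_add.
  have Y'n : Y' n = E (n - 3).
    by have := Y'_end 2; rewrite subnK; [move=> ->; congr E|]; lia.
  have SY' : straight n Y'.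
    apply: opp_walk_straight; first by rewrite Y'_beg // Y'n -FF'0 F0.
    have n2 : n - 2 + 2 = n by lia.
    rewrite -[n in walk n]n2; apply: walk_glue => //.
      by apply: walk_bwd (proj1 SF'); lia.
    by apply: walk_bwd (proj1 SE); lia.
  have BX' : bigon X' Y'.
    split=> //.
    - by rewrite Y'_beg // -FF'0 F0.
    - by rewrite Y'n -X'_end; congr X'; lia.
    - by rewrite Y'_beg ?F'1 //; lia.
  have := bigon_last BX'.
  have -> : n.-1 = 3 + (n - 4) by lia.
  rewrite X'_end (_ : 3 + (n - 4) = n - 2 + 1); last lia.
  rewrite Y'_end; apply.
  have := proj2 SE (n - 3).
  have -> : (n - 3).-1 = n - 4 by lia.
  have -> : (n - 3).+1 = n.-1 - 1 by lia.
  by apply; lia.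
have uE4 : u (X 4) (E 1) = 0%E.
  apply: (u_eq0_transfer X43 X23 E13); first last.
    by rewrite (u_sym X23 E13).
  by rewrite (u_sym X43 X23); apply: (proj2 SX 3); lia.
have O4 : opp (Y n.-1) (E 4).
  apply: (equiv_opp equivXY).
  have <- : fwd 3 X (n - 4) = X n.-1 by rewrite /fwd; congr X; lia.
  apply: opp_glue => //; first lia.
  - by apply: straight_fwd SX; lia.
  - by apply: (straight_fwd (s := 0) _ SE); lia.
have [n5|n6] : n = 5 \/ n = 6 by lia.
  apply: near; first lia.
  by move: O4; rewrite -[4]/(5.-1) -n5 En1 n5.
(* For n = 6 the walk W of length 6 joins the residually opposite Y 5 and E 4,
   so its turn at F' 4 is zero; then E 2 is residually opposite to Y 1, hence to
   X 1, although it is at distance at most 4 from X 1. *)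
have n51 : n.-1 = 5 by lia.
rewrite n51 in O4 En1.
have IY i : i < 6 -> I (Y i.+1) (Y i) by move=> i6; apply/inc_sym/(proj1 SY); lia.
have IF i : i < 6 -> I (F' i) (F' i.+1) by move=> i6; apply/(proj1 SF'); lia.
have IE i : i < 6 -> I (E i) (E i.+1) by move=> i6; apply/(proj1 SE); lia.
pose W := nth (E 4) [:: Y 5; Y 4; Y 3; Y 2; F' 3; F' 4].
have WW : walk n W.
  move=> i; rewrite n6; case: i => [|[|[|[|[|[|//]]]]]] _; rewrite /W /=.
  - exact: IY.
  - exact: IY.
  - exact: IY.
  - by rewrite -F'2; exact: IF.
  - exact: IF.
  - by apply: inc_sym; have <- : E 5 = F' 4 := En1; exact: IE.
have Wn : W n = E 4 by rewrite /W n6.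
have SW : straight n W by apply: opp_walk_straight => //; rewrite Wn.
have u34 : u (F' 3) (E 4) = 0%E by apply: (proj2 SW 5); lia.
have O2 : opp (Y 1) (E 2).
  rewrite -F'1; apply: (@opp_glue 3 3 (bwd 4 F') (bwd 5 E)) => //.
  - by apply: straight_bwd SF'; lia.
  - by apply: straight_bwd SE; lia.
have {}O2 := equiv_opp (esym (bigon_equiv1 BX)) O2.
have := @opp_glue_far 2 2 (bwd 3 X) E O2.
have H1 : walk 2 (bwd 3 X) by apply: walk_bwd (proj1 SX); lia.
have H2 : walk 2 E by apply: (walk_fwd (s := 0) _ (proj1 SE)); lia.
by move=> /(_ H1 H2 (esym E0)); rewrite n6.
Qed.

Hypothesis n_le6 : n <= 6.

(** Prolonging [V] by a straight step gives an element residually opposite [V 1],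
    hence [y]; a straight walk between these two can be chosen through [V n]. *)
Lemma equiv_walk V y : straight n V -> V 1 ~ y ->
  exists H, [/\ straight n H, H 0 = y & H n.-1 = V n].
Proof.
move=> SV eqv1.
have [|V' SV' V'E] := straight_extend (m := n.+1) _ SV; first lia.
have V'w : I (V n) (V' n.+1) by rewrite -V'E //; apply: (proj1 SV').
have O1 : opp y (V' n.+1).
  apply: (equiv_opp eqv1).
  have <- : fwd 1 V' 0 = V 1 by rewrite /fwd V'E //; lia.
  by apply: straight_opp; apply: straight_fwd SV'; lia.
have [U [SU U0 U1 Un]] := opp_walk_through (opp_sym O1) (inc_sym V'w).
exists (bwd n U); split.
- by apply: straight_bwd SU; rewrite leqnn.
- by rewrite /bwd subn0.
- by rewrite -U1 /bwd; congr U; lia.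
Qed.

(** A straight walk from [X 2] to [w] through [X 1] has a counterpart [H] from
    [Y 1] to [w].  If [Y 2] is not residually opposite [w], then [H 1] is
    equivalent to [Y 2].  Replacing [w] by the equivalent element [K n.-1], which
    is reached from [Y 1] through [Y 2] itself, yields two bigons as excluded by
    [bigons_diverge]. *)
Lemma bigon_opp2 X Y w : 3 < n -> bigon X Y -> opp (X 2) w -> opp (Y 2) w.
Proof.
move=> n_gt3 BX O; have [SX SY XY0 XYn u1] := BX.
have [V [SV V0 V1 Vn]] : exists V, [/\ straight n V, V 0 = X 2, V 1 = X 1 & V n = w].
  by apply: opp_walk_through O _; apply/inc_sym/(proj1 SX); lia.
have eqv1 : V 1 ~ Y 1 by rewrite V1; exact: bigon_equiv1.
have [H [SH H0 Hn1]] := equiv_walk SV eqv1; rewrite Vn in Hn1.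
have O1 : opp (Y 1) (H n) by rewrite -H0; exact: straight_opp.
have SH1 : straight n.-1 H by apply: (straight_fwd (s := 0) _ SH); lia.
have n1 : 1 + n.-1 = n by lia.
case: (pselect (u (Y 2) (H 1) = 0%E)) => [uY|uY].
  rewrite -Hn1; apply: (@opp_glue 1 n.-1 (fwd 1 Y)) => //.
  by apply: straight_fwd SY; lia.
exfalso.
have Y01 : I (Y 0) (Y 1) by apply: (proj1 SY); lia.
have Y12 : I (Y 1) (Y 2) by apply: (proj1 SY); lia.
have YH : I (H 1) (Y 1) by rewrite -H0; apply/inc_sym/(proj1 SH); lia.
have uH : u (Y 0) (H 1) = 0%E.
  apply: (u_eq0_transfer Y01 (inc_sym Y12) YH) uY.
  by apply: (proj2 SY 1); lia.
have SY10 : straight 1 (bwd 1 Y) by apply: straight_bwd SY; lia.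
have OM : opp (X 0) w by rewrite XY0 -Hn1; apply: (@opp_glue 1 n.-1 (bwd 1 Y)).
have [K [SK K0 K1 Kn]] := opp_walk_through O1 Y12.
have BH : bigon H K.
  split=> //; [by rewrite H0 | rewrite K1 (u_sym YH (inc_sym Y12)) //].
have wm : w ~ K n.-1 by rewrite -Hn1; exact: bigon_equiv_last.
have OX2 := opp_sym (equiv_opp wm (opp_sym O)).
have {}OM := opp_sym (equiv_opp wm (opp_sym OM)).
have [F [SF F0 F1 Fn]] : exists F,
    [/\ straight n F, F 0 = X 0, F 1 = X 1 & F n = K n.-1].
  by apply: opp_walk_through OM _; apply: (proj1 SX); lia.
pose F' := glue 1 (bwd 1 Y) K.
have F'K k : F' (1 + k) = K k by rewrite /F' glue_add.
have F'1 : F' 1 = Y 1 by rewrite -K0; exact: (F'K 0).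
have F'2 : F' 2 = Y 2 by rewrite -K1; exact: (F'K 1).
have F'n : F' n = K n.-1 by rewrite -F'K n1.
have SF' : straight n F'.
  apply: opp_walk_straight; first by rewrite F'n /F' glue_le // /bwd -XY0.
  rewrite -[n in walk n]n1; apply: walk_glue => //; first exact: (proj1 SY10).
  by apply: (walk_fwd (s := 0) _ (proj1 SK)); lia.
have BF : bigon F F'.
  split=> //; last by rewrite F'1 F1.
    by rewrite F0 /F' glue_le.
  by rewrite F'n.
apply: (bigons_diverge _ BX BF) => //.
- by rewrite n_gt3.
apply: (@opp_glue_turn 1 n.-1 (fwd 1 X) (fwd 1 F)) => //; first lia.
- by rewrite {2}/fwd n1 Fn.
- by apply: walk_fwd (proj1 SX); lia.
- by apply: walk_fwd (proj1 SF); lia.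
Qed.

(** For [n = 3] this is the case [i = n - 1], settled by [bigon_last]. *)
Lemma bigon_equiv2 X Y : bigon X Y -> X 2 ~ Y 2.
Proof.
move=> B; case: (ltngtP 3 n) => n3; [|lia|].
  by apply: equivI => w; apply: bigon_opp2 => //; exact: bigon_sym.
have -> : 2 = n.-1 by lia.
exact: bigon_equiv_last.
Qed.

Lemma equiv_adjacent x y z : I x z -> I y z -> x ~ y -> u x y <> 0%E.
Proof.
move=> xz yz xy uxy; pose w := nth y [:: x; z].
apply: (@straight_inequiv 2 w) => //; first lia.
split=> [[|[|]]|[|[|]]] // _; exact: inc_sym.
Qed.

(** As in [bigon_opp2], compare straight walks [V] and [g] to [w] that start in
    [X 3, X 2] and in [Y 2], and suppose that [Y 3] is not residually opposite
    [w], so that [g 1 ~ Y 3].  Then [X 0, X 1, V 1, V 2, ...] is the first side [F]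
    of a bigon whose second side [H] passes through [Y 1].  By [bigon_equiv2],
    [H 2 ~ Y 2]; by the same lemma, applied to the bigon [A], [B] from [Y 1] to
    [w], [H 3 ~ g 1].  So [H 3 ~ Y 3].  But [H 3] is joined to [F n] by a walk of
    length 3, whereas [Y 4], being equivalent to [X 4], is residually opposite
    [F n], so a straight walk of length 5 joins [Y 3] to [F n].  An element
    prolonging the latter is residually opposite [Y 3] but too close to [H 3]. *)
Lemma bigon_opp3 X Y w : n = 6 -> bigon X Y -> opp (X 3) w -> opp (Y 3) w.
Proof.
move=> n6 BX O; have [SX SY XY0 XYn u1] := BX.
have eqv2 := bigon_equiv2 BX.
have [V [SV V0 V1 Vn]] : exists V, [/\ straight n V, V 0 = X 3, V 1 = X 2 & V n = w].
  by apply: opp_walk_through O _; apply/inc_sym/(proj1 SX); lia.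
have [|g [Sg g0 gn1]] := @equiv_walk V (Y 2) SV; first by rewrite V1.
rewrite Vn in gn1.
have n1 : 1 + n.-1 = n by lia.
have Sg1 : straight n.-1 g by apply: (straight_fwd (s := 0) _ Sg); lia.
case: (pselect (u (Y 3) (g 1) = 0%E)) => [uY|uY].
  rewrite -gn1; apply: (@opp_glue 1 n.-1 (fwd 2 Y)) => //.
  by apply: straight_fwd SY; lia.
exfalso.
have Y12 : I (Y 1) (Y 2) by apply: (proj1 SY); lia.
have Y32 : I (Y 3) (Y 2) by apply/inc_sym/(proj1 SY); lia.
have gY : I (g 1) (Y 2) by rewrite -g0; apply/inc_sym/(proj1 Sg); lia.
have uYg : u (Y 1) (g 1) = 0%E.
  apply: (u_eq0_transfer Y12 Y32 gY) uY.
  by apply: (proj2 SY 2); lia.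
have SY21 : straight 1 (bwd 2 Y) by apply: straight_bwd SY; lia.
have SV1 : straight n.-1 (fwd 1 V) by apply: straight_fwd SV; lia.
have O1 : opp (X 1) (V n).
  apply: (equiv_opp (esym (bigon_equiv1 BX))); rewrite Vn -gn1.
  exact: (@opp_glue 1 n.-1 (bwd 2 Y)).
have uXV : u (X 1) (V 2) = 0%E.
  apply: (@opp_glue_turn 1 n.-1 (bwd 2 X) (fwd 1 V)) => //; try lia.
  - by rewrite /fwd n1.
  - by apply: walk_bwd (proj1 SX); lia.
  - exact: (proj1 SV1).
pose F := glue 2 (bwd 2 X) (fwd 1 V).
have FV k : F (2 + k) = V k.+1 by rewrite /F glue_add.
have Fn : F n = V n.-1 by have := FV (n - 2); rewrite subnKC; [move=> ->; congr V|]; lia.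
have Fn1 : F n.-1 = V n.-2.
  by have := FV (n - 3); rewrite (_ : 2 + (n - 3) = n.-1); [move=> ->; congr V|]; lia.
have n2 : 2 + (n - 2) = n by lia.
have SV2 : straight (n - 2) (fwd 1 V) by apply: straight_fwd SV; lia.
have SF : straight n F.
  rewrite -[n in straight n]n2; apply: straight_glue => //.
  by apply: straight_bwd SX; lia.
have [H BF H1] : exists2 H, bigon F H & H 1 = Y 1.
  apply: bigon_exists => //.
  by rewrite -[F 0]/(X 0) XY0; apply: (proj1 SY); lia.
have [_ SH FH0 FHn _] := BF.
have H2Y2 : H 2 ~ Y 2 by rewrite -eqv2 -(bigon_equiv2 BF) (FV 0) V1.
have HY1 : I (H 2) (Y 1) by rewrite -H1; apply/inc_sym/(proj1 SH); lia.
have uHY := equiv_adjacent HY1 (inc_sym Y12) H2Y2.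
have VF : I (V n) (F n).
  by rewrite Fn; apply/inc_sym; have := proj1 SV n.-1; rewrite prednK; [apply|]; lia.
have uVH : u (V n) (H n.-1) = 0%E.
  have in1 W : straight n W -> I (W n.-1) (W n).
    by move=> [+ _] => /(_ n.-1); rewrite prednK; [apply|]; lia.
  apply: (u_eq0_transfer VF (in1 _ SF)); last exact: bigon_last.
    by rewrite FHn; exact: in1.
  rewrite (u_sym VF (in1 _ SF)) Fn1.
  by have := proj2 SV n.-1; rewrite prednK; [apply|]; lia.
pose A := glue n.-1 (bwd n H) (fwd n.-1 V).
have Hn0 : bwd n H 0 = fwd n.-1 V 0 by rewrite /bwd /fwd subn0 addn0 -Fn.
have SA : straight n A.
  rewrite -[n in straight n](_ : n.-1 + 1 = n); last lia.
  apply: straight_glue => //.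
  - by apply: straight_bwd SH; lia.
  - by apply: straight_fwd SV; lia.
  - rewrite /bwd /fwd subn1 (_ : n.-1 + 1 = n); last lia.
    by rewrite (u_sym _ VF) // FHn; have := proj1 SH n.-1; rewrite prednK; [apply|]; lia.
have AH k : k < n -> A k = H k.+1.
  by move=> kn; rewrite /A glue_le /bwd; [congr H|]; lia.
have An : A n = V n.
  rewrite (_ : n = n.-1 + 1); last lia.
  by rewrite /A glue_add.
pose B := glue 1 (bwd 2 Y) g.
have Bg k : B (1 + k) = g k by rewrite /B glue_add.
have SB : straight n B.
  by rewrite -[n in straight n]n1; apply: straight_glue.
have BA : bigon A B.
  split=> //.
  - by rewrite AH ?H1 //; lia.
  - by rewrite An Vn -n1 Bg.
  - by rewrite AH ?(Bg 0) ?g0 //; lia.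
have Y3H3 : Y 3 ~ H 3.
  have := bigon_equiv2 BA; rewrite AH ?(Bg 1); last lia.
  by move=> ->; exact: adjacent_equiv Y32 gY uY.
have O4 : opp (Y 4) (V n.-1).
  have := bigon_equiv2 (bigon_rev BX).
  rewrite /bwd (_ : n - 2 = 4); last lia.
  move=> eqv4; apply: (equiv_opp eqv4).
  have <- : fwd 1 V (n - 2) = V n.-1 by rewrite /fwd; congr V; lia.
  apply: (@opp_glue 2 (n - 2) (fwd 2 X)) => //.
    by apply: straight_fwd SX; lia.
  by rewrite -[fwd 2 X 1]/(X 3) -V0; apply: (proj2 SV 1); lia.
have Y34 : I (Y 4) (Y 3) by apply/inc_sym/(proj1 SY); lia.
have [C [SC C0 C1 Cn]] := opp_walk_through O4 Y34.
have [|C' SC' C'E] := straight_extend (m := n.+1) _ SC; first lia.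
have : opp (H 3) (C' n.+1).
  apply: (equiv_opp Y3H3); have <- : fwd 1 C' 0 = Y 3 by rewrite /fwd C'E //; lia.
  by apply: straight_opp; apply: straight_fwd SC'; lia.
have <- : bwd n H 3 = H 3 by rewrite /bwd; congr H; lia.
have <- : fwd n C' 1 = C' n.+1 by rewrite /fwd addn1.
move/opp_glue_far => far; suff : n <= 3 + 1 by lia.
apply: far.
- by apply: walk_bwd (proj1 SH); lia.
- by apply: walk_fwd (proj1 SC'); lia.
- by rewrite /bwd /fwd subn0 addn0 C'E // Cn -Fn.
Qed.

Lemma bigon_equiv X Y i : bigon X Y -> i <= n -> X i ~ Y i.
Proof.
move=> B i_n; have BR := bigon_rev B.
have : i = 0 \/ i = 1 \/ i = 2 \/ (i = 3 /\ n = 6) \/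
  i = n \/ i = n - 1 \/ i = n - 2 by lia.
case=> [->|[->|[->|[[-> n6]|[->|[->|->]]]]]].
- by case: B => _ _ ->.
- exact: bigon_equiv1.
- exact: bigon_equiv2.
- by apply: equivI => w; apply: bigon_opp3 => //; exact: bigon_sym.
- by case: B => _ _ _ ->.
- exact: bigon_equiv1 BR.
- exact: bigon_equiv2 BR.
Qed.

(** * Lifting residual incidences *)

Lemma equiv_lift l w L : l <= n -> walk l w -> w 0 ~ w l -> I (w 0) L ->
  exists2 L', I (w l) L' & L ~ L'.
Proof.
elim/ltn_ind: l w L => l IH w L l_n W E0 w0L.
case: (posnP l) => [l0|l_gt0]; first by exists L; rewrite ?l0.
(* A straight walk of this length cannot have equivalent ends. *)
have noflat : exists i, `[< 0 < i < l /\ u (w i.-1) (w i.+1) <> 0%E >].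
  apply: contrapT => noi; apply: (@straight_inequiv l w) => //; first lia.
  split=> // i il; apply: contrapT => ui; apply: noi; exists i.
  exact/asboolP.
case: (ex_minnP noflat) => i /asboolP[il ui] imin.
have Si : straight i w.
  split=> [k ki|k ki]; first by apply: W; lia.
  apply: contrapT => uk; have : i <= k; last lia.
  by apply/imin/asboolP; split=> //; lia.
have w10 : I (w 1) (w 0) by apply/inc_sym/W; lia.
have [L2 [w0L2 uL2 LL2]] : exists L2, [/\ I (w 0) L2, u (w 1) L2 = 0%E
    & u (w 1) L <> 0%E \/ L2 = L].
  case: (pselect (u (w 1) L = 0%E)) => uL; first by exists L; split=> //; right.
  by have [L2 w0L2 uL2] := straight_step w10; exists L2; split=> //; left.
(* The folding pair starts at w i: X runs back along w to w 0, then to L2. *)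
pose s k := if k is 0 then w 0 else L2.
have Ss : straight (i + 1) (glue i w s).
  by apply: straight_glue => //; split=> [[|]|[|]].
have [|X SX Xs] := straight_extend (m := n) _ Ss; first lia.
have XE k : k <= i -> X k = w (i - k) by move=> ki; rewrite Xs ?glue_le //; lia.
have Xi : X i.+1 = L2 by rewrite -addn1 Xs // glue_add.
have [Y BX Y1] : exists2 Y, bigon X Y & Y 1 = w i.+1.
  apply: bigon_exists => //; first by rewrite XE // subn0; apply: W; lia.
  by rewrite XE ?subn1 //; lia.
have XY := bigon_equiv BX.
have WY : walk n Y by case: BX => _ [].
have Yi : w 0 ~ Y i by rewrite -XY ?XE ?subnn //; lia.
have [L1 YL1 LL1] : exists2 L1, I (Y i) L1 & L ~ L1.
  case: LL2 => [uL|L2L].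
    exists (Y i.-1).
      by apply/inc_sym; have := WY i.-1; rewrite prednK; [apply|]; lia.
    rewrite -XY ?XE; try lia.
    rewrite (_ : i - i.-1 = 1); last lia.
    by apply/esym; apply: (adjacent_equiv w10 (inc_sym w0L)).
  exists (Y i.+1); first by apply: WY; lia.
  by rewrite -XY ?Xi ?L2L //; lia.
(* Back along Y to Y 1 = w i.+1 and on along w: two steps shorter than w. *)
pose w' := glue i.-1 (fwd 1 Y) (fwd i.+1 w).
have w'0 : w' 0 = Y i by rewrite /w' glue_le // /fwd; congr Y; lia.
have w'l : w' (i.-1 + (l - i.+1)) = w l.
  by rewrite /w' glue_add /fwd ?addn0 //; congr w; lia.
have [|||||L' wL' LL'] := IH (i.-1 + (l - i.+1)) _ w' L1; rewrite ?w'0 ?w'l.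
- lia.
- lia.
- apply: walk_glue; first by apply: walk_fwd WY; lia.
    by apply: walk_fwd W; lia.
  by rewrite /fwd !addn0.
- by rewrite -Yi.
- by [].
by exists L'; [rewrite -w'l | rewrite LL1].
Qed.

(** * The residue *)

Local Notation class := (residual_class n G u).
Local Notation residueG := (residue n G u).

Lemma class_self x : elements G x -> class x x.
Proof. by []. Qed.

Lemma class_equiv x y : x ~ y -> class x = class y.
Proof. by rewrite /residual_class => ->. Qed.

Lemma equiv_class x y : elements G y -> class x = class y -> x ~ y.
Proof. by move=> /class_self + E; rewrite -E => -[]. Qed.

Lemma exists_opp x : elements G x -> exists y, opp x y.
Proof.
move=> ex; have [y [_ [yx _ _]]] := valuation_U1 valG ex.
pose w i := if i is 0 then x else y.
have Sw : straight 1 w.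
  by split=> [[|i]|[|i]] // _; exact: inc_sym.
have [|v Sv vE] := straight_extend (m := n) _ Sw; first lia.
by exists (v n); rewrite -[x]/(w 0) -vE //; exact: straight_opp.
Qed.

Lemma opp_point x y : opp x y -> `[< points G y >] = odd n (+) `[< points G x >].
Proof. by move=> /oppP[w [[W _] <- <-]]; exact: walk_point. Qed.

(** Walks of length [n] to a common residually opposite element have ends whose
    types determine each other by parity. *)
Lemma equiv_point x y : elements G x -> x ~ y -> points G x -> points G y.
Proof.
move=> ex xy px; have [z xz] := exists_opp ex.
have := opp_point xz; rewrite (opp_point (equiv_opp xy xz)) => /addbI E.
by apply/asboolP; rewrite E; exact/asboolP.
Qed.

Lemma residue_elementP X : elements residueG X <->
  exists2 x, elements G x & X = class x.
Proof.
split=> [[[x px <-]|[x lx <-]]|[x [px|lx] ->]].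
- by exists x => //; left.
- by exists x => //; right.
- by left; exists x.
- by right; exists x.
Qed.

Lemma inc_residue x y : I x y -> inc residueG (class x) (class y).
Proof.
move=> xy; split.
  case: (inc_type xy) => -[H1 H2]; [left|right].
    by split; [exists x|exists y].
  by split; [exists x|exists y].
have [ex ey] := (inc_element xy, inc_element (inc_sym xy)).
by exists x, y.
Qed.

Lemma residue_inc_lift x Y : elements G x -> inc residueG (class x) Y ->
  exists2 y, I x y & Y = class y.
Proof.
move=> ex [XY [p [q [[ep xp] Yq pq]]]].
have Yclass : Y = class q.
  by case: XY Yq => -[_ [d _ <-]] [eq dq]; exact: class_equiv.
have [k [w [kn [/path_walk W W0 Wk]]]] := polygon_GP2 polG ep ex.
have [||y xy qy] := equiv_lift (L := q) kn W.
- by rewrite W0 Wk.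
- by rewrite W0.
exists y; first by rewrite -Wk.
by rewrite Yclass; exact: class_equiv.
Qed.

Lemma residue_walk_lift k V x : elements G x -> is_path residueG k V ->
  V 0 = class x ->
  exists w, [/\ walk k w, w 0 = x & forall i, i <= k -> V i = class (w i)].
Proof.
move=> ex; elim: k => [|k IH] [E W] V0.
  by exists (fun=> x); split=> // -[].
have [|w [Ww w0 wE]] := IH _ V0.
  by split=> i ik; [apply: E | apply: W]; lia.
have ek : elements G (w k).
  case: (k) Ww => [|j] Wj; first by rewrite w0.
  exact: inc_element (inc_sym (Wj j (leqnn _))).
have := W k (leqnn _); rewrite wE // => /(residue_inc_lift ek)[y wy Vy].
exists (fun i => if i <= k then w i else y); split=> // i ik.
  case: (ltngtP i k) => ik'; [|lia|by rewrite ik'].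
  exact: Ww.
case: (leqP i k) => ik'; first exact: wE.
by rewrite (_ : i = k.+1) //; lia.
Qed.

(** Cutting out a backtracking step shortens the path by two. *)
Lemma geodesic_reduced k V X Y i : at_distance residueG k X Y ->
  path_from_to residueG k V X Y -> 0 < i < k -> V i.-1 <> V i.+1.
Proof.
move=> [_ D] [[E W] V0 Vk] ik Vi.
pose s t := if t < i then V t else V t.+2.
suff : k <= k - 2 by lia.
apply: (D _ s); split.
- split=> t tk; rewrite /s; first by case: ifP => _; apply: E; lia.
  case: (ltngtP t.+1 i) => ti.
  + by apply: W; lia.
  + by apply: W; lia.
  + have -> : t = i.-1 by lia.
    rewrite Vi (_ : i.-1.+3 = i.+2); last lia.
    by apply: W; lia.
- by rewrite /s; case/andP: ik => ->.
rewrite /s; case: ltnP => ki; last by rewrite -Vk; congr V; lia.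
rewrite -Vk (_ : k = i.+1); last lia.
by rewrite -Vi; congr V; lia.
Qed.

(** A nonzero turn of a lift means equal classes two steps apart. *)
Lemma geodesic_straight k V X Y j l w : at_distance residueG k X Y ->
  path_from_to residueG k V X Y -> j + l <= k -> walk l w ->
  (forall i, i <= l -> V (j + i) = class (w i)) -> straight l w.
Proof.
move=> D P jlk W VE; split=> // i il; apply: contrapT => ui.
apply: (geodesic_reduced (i := j + i) D P); first lia.
have -> : (j + i).-1 = j + i.-1 by lia.
rewrite -addnS !VE; try lia.
apply: class_equiv; apply: (@adjacent_equiv _ _ (w i)) => //.
  by have := W i.-1; rewrite prednK; [apply|]; lia.
by apply/inc_sym/W; lia.
Qed.

(** Lift both paths from a representative of their last common element, which
    precedes the first index [j] where they differ.  The two lifts leave it along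
    inequivalent elements, so together they form a straight walk contradicting
    [straight_inequiv]. *)
Lemma residue_GP3 X Y k V W : k < n -> at_distance residueG k X Y ->
  path_from_to residueG k V X Y -> path_from_to residueG k W X Y ->
  forall i, i <= k -> V i = W i.
Proof.
move=> kn D PV PW; have [HV V0 Vk] := PV; have [HW W0 Wk] := PW.
have /residue_elementP[x0 ex0 Xx0] : elements residueG X.
  by rewrite -V0; apply: (proj1 HV).
have [x [Wx x_0 xE]] := residue_walk_lift ex0 HV (etrans V0 Xx0).
have Sx : straight k x by apply: (geodesic_straight (j := 0) D PV).
move=> i ik; apply: contrapT => VWi.
have noteq : exists i, `[< i <= k /\ V i <> W i >].
  by exists i; apply/asboolP.
case: (ex_minnP noteq) => j /asboolP[jk VWj] jmin {i ik VWi noteq}.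
have j0 : 0 < j by case: (posnP j) VWj => // ->; rewrite V0 W0.
have agree i : i < j -> V i = W i.
  move=> ij; apply: contrapT => VWi.
  by have : j <= i by [apply/jmin/asboolP; split=> //; lia]; lia.
have el i : i <= k -> elements G (x i).
  case: i => [|i] ik; first by rewrite x_0.
  exact: inc_element (inc_sym (Wx i ik)).
have HWj : is_path residueG (k - j.-1) (fun i => W (j.-1 + i)).
  split=> i ik; first by apply: (proj1 HW); lia.
  by rewrite addnS; apply: (proj2 HW); lia.
have [||y [Wy y0 yE]] := @residue_walk_lift _ _ (x j.-1) _ HWj.
- by apply: el; lia.
- by rewrite addn0 -agree ?xE //; lia.
have Sy : straight (k - j.-1) y.
  by apply: (geodesic_straight (j := j.-1) D PW) => //; lia.
pose v := fwd j.-1 x.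
have Sv : straight (k - j.-1) v by apply: straight_fwd Sx; lia.
have v0y0 : v 0 = y 0 by rewrite y0 /v /fwd addn0.
have j1 : j.-1 + 1 = j by lia.
have uvy : u (v 1) (y 1) = 0%E.
  apply: contrapT => uvy; apply: VWj.
  have := yE 1; rewrite j1 => ->; last lia.
  rewrite xE //; apply: class_equiv.
  rewrite -[in x j]j1; apply: (@adjacent_equiv _ _ (v 0)) => //.
    by apply/inc_sym/(proj1 Sv); lia.
  by rewrite v0y0; apply/inc_sym/(proj1 Sy); lia.
have Sg := straight_glue Sv Sy v0y0 uvy.
apply: straight_inequiv Sg _; first lia.
rewrite glue_le // glue_add // subn0 /v /fwd subnKC; last lia.
have eyk : elements G (y (k - j.-1)).
  have := Wy (k - j); rewrite (_ : (k - j).+1 = k - j.-1); last lia.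
  by move=> H; apply: inc_element (inc_sym (H _)); lia.
apply: equiv_class => //.
by rewrite -yE // -xE // subnKC ?Vk ?Wk //; lia.
Qed.

Lemma residue_weak_polygon : weak_generalized_polygon residueG n.
Proof.
split.
- lia.
- split=> [|X Y [XY [x [y [Xx Yy xy]]]]|X Y [XY _]] //.
    rewrite predeqE => X; split=> // -[[x px <-] [y ly]] /esym xy.
    apply: (@point_not_line y) => //; apply: (equiv_point _ _ px); first by left.
    by apply: equiv_class => //; right.
  split; first by case: XY => -[]; [right|left].
  by exists y, x; split=> //; exact: inc_sym.
- move=> _ /residue_elementP[x ex ->].
  have [y [z [yx zx yz]]] := valuation_U1 valG ex.
  pose f i := if i is 0 then class y else class z.
  have yzN : class y <> class z.
    move=> /(equiv_class (inc_element zx)) eyz.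
    exact: equiv_adjacent yx zx eyz yz.
  have fI : {in `I_2 &, injective f}.
    by move=> [|[|i]] [|[|j]]; rewrite !inE //= => _ _ // /esym.
  rewrite -(card_le_eql (inj_card_eq fI)); apply: subset_card_le.
  by move=> _ [[|i] _ <-]; apply: inc_residue; exact: inc_sym.
- move=> _ _ /residue_elementP[x ex ->] /residue_elementP[y ey ->].
  have [k [w [kn [[E W] W0 Wk]]]] := polygon_GP2 polG ex ey.
  exists k, (fun i => class (w i)); split=> //.
  split; [split=> i ik | by rewrite W0 | by rewrite Wk].
    by apply/residue_elementP; exists (w i) => //; exact: E.
  by apply: inc_residue; exact: W.
- by move=> X Y k V W kn D PV PW; exact: residue_GP3 D PV PW.
Qed.

End Walks.

Theorem mainTheorem2 (R : realType) (T : Type) (n : nat) (G : geometry T)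
    (a : nat -> R) (u : T -> T -> \bar R) :
  (3 <= n <= 6)%N ->
  generalized_polygon_with_valuation n G a u ->
  weak_generalized_polygon (residue n G u) n.
Proof.
move=> /andP[n_ge3 n_le6] [polG valG].
exact: residue_weak_polygon n_ge3 polG valG n_le6.
Qed.
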